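(* Let $H$ be an infinitely divisible distribution supported on $[0,\infty)$ with Laplace transform $$\int_0^\infty e^{-\lambda y}H(dy)=\exp\Big\{-a\lambda-\int_0^\infty(1-e^{-\lambda y})\upsilon(dy)\Big\},$$ where $a\ge 0$ and $\upsilon$ is its Lévy measure, with Lévy spectral distribution $F$ and decomposition $H=H_1*H_2$ (all as in the context). Assume that $H\in\mathcal{L}(\gamma)\cap\mathcal{OS}$ for some $\gamma\ge0$ and that $\overline{H_1}(x)=o\big(\overline{H_2}(x)\big)$. Suppose further that, for all integers $k\ge1$, $$\liminf_{x\to\infty}\frac{\overline{F^{*k}}(x-t)}{\overline{F^{*k}}(x)}\ge e^{\gamma t}\quad\text{for all } t>0 .$$ Then $H_2\in\mathcal{L}(\gamma)\cap\mathcal{OS}$ and $\overline{H_2}(x)\approx\overline{H}(x)$. Moreover, there exists an integer $n_0\ge1$ such that $F^{*n}\in\mathcal{L}(\gamma)\cap\mathcal{OS}$ for all $n\ge n_0$. Further, if $n_0\ge2$ and there exists an integer $1\le l_0\le n_0-1$ such that $F^{*l_0}\in\mathcal{OS}$, then $F^{*n}\in\mathcal{L}(\gamma)\cap\mathcal{OS}$ for all $n\ge l_0$. In particular, if $l_0=1$, that is, $F\in\mathcal{OS}$, then $F\in\mathcal{L}(\gamma)\cap\mathcal{OS}$.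
   Context: All limits are as $x\to\infty$. For a distribution $V$, $\overline V=1-V$ is its tail; $V^{*k}$ is the $k$-fold convolution of $V$ with itself, $V^{*0}$ being the distribution degenerate at $0$. For positive functions, $f\approx g$ means $f=O(g)$ and $g=O(f)$; $f\sim g$ means $f/g\to1$. Any condition on a ratio as $x\to\infty$ presupposes that its denominator is positive for all sufficiently large $x$. Lévy data: $\upsilon$ is a Borel measure on $(0,\infty)$ with $\mu:=\upsilon((1,\infty))\in(0,\infty)$ and $\int_0^1 y\,\upsilon(dy)<\infty$. The Lévy spectral distribution is $F(x)=\frac{\upsilon((1,x])}{\mu}\mathbf 1(x>1)$, $x\in\mathbb R$. The decomposition $H=H_1*H_2$ is the one with $H_2(x)=e^{-\mu}\sum_{k=0}^\infty F^{*k}(x)\mu^k/k!$ and $H_1$ the infinitely divisible distribution with drift $a$ and Lévy measure $\upsilon$ restricted to $(0,1]$; it satisfies $\overline{H_1}(x)=O(e^{-\beta x})$ for some $\beta>0$. Classes: for $\gamma\ge0$, $V\in\mathcal L(\gamma)$ if $\overline V(x)>0$ for all $x$ and $\overline V(x-t)\sim e^{\gamma t}\,\overline V(x)$ for every fixed $t>0$ (if $\gamma>0$ and $V$ is lattice, $x$ and $t$ are restricted to multiples of the lattice span). $V\in\mathcal{OS}$ if $\limsup\overline{V^{*2}}(x)/\overline V(x)<\infty$. *)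

(* Defs.v *)
From HB Require Import structures.
From mathcomp Require Import all_boot all_order all_algebra.
From mathcomp Require Import all_classical all_reals all_analysis.

Set Implicit Arguments.
Unset Strict Implicit.
Unset Printing Implicit Defensive.

Import Order.TTheory GRing.Theory Num.Theory.
Import numFieldNormedType.Exports.

Local Open Scope classical_set_scope.
Local Open Scope ring_scope.

(* Landau notations need the filter of neighbourhoods of +oo as a canonical
   filter_on. *)
Canonical pinfty_nbhs_filter_on (R : realType) : filter_on R :=
  FilterType (pinfty_nbhs R) _.

Notation dist R := (probability R R).

Definition tail (R : realType) (V : dist R) (x : R) : R :=
  fine (V `]x, +oo[%classic).

Section convolution.
Context {R : realType}.

Definition add_pair (z : R * R) : R := z.1 + z.2.

Lemma measurable_add_pair : measurable_fun [set: R * R] add_pair.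
Proof. exact: measurable_realfun.measurable_funD. Qed.

HB.instance Definition _ :=
  isMeasurableFun.Build _ _ _ _ add_pair measurable_add_pair.

Definition conv_dist (V W : dist R) : dist R := distribution (V \x W)%E add_pair.

Fixpoint conv_pow (V : dist R) (k : nat) : dist R :=
  if k is k'.+1 then conv_dist V (conv_pow V k') else \d_(0 : R).

End convolution.

Section classes.
Context {R : realType}.
Implicit Types (V : dist R) (gamma : R).

Definition concentrated_on_lattice V (c d : R) : Prop :=
  0 < d /\ V [set c + d * m%:~R | m in [set: int]] = 1%E.

Definition lattice V : Prop := exists c d, concentrated_on_lattice V c d.

Definition lattice_span V (d : R) : Prop :=
  (exists c, concentrated_on_lattice V c d) /\
  (forall c' d', concentrated_on_lattice V c' d' -> d' <= d).

(* The lattice clause samples the tail at x = n d with shift t = k d; a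
   distribution with positive tail is never a point mass, so if it is lattice
   its span exists. *)
Definition class_L gamma V : Prop :=
  [/\ forall x, 0 < tail V x,
      (gamma = 0 \/ ~ lattice V) -> forall t, 0 < t ->
        tail V (x - t) / tail V x @[x --> +oo] --> expR (gamma * t) &
      0 < gamma -> forall d, lattice_span V d -> forall k : nat, (0 < k)%N ->
        tail V (d * n%:R - d * k%:R) / tail V (d * n%:R) @[n --> \oo]
          --> expR (gamma * (d * k%:R))].

Definition class_OS V : Prop :=
  (\forall x \near +oo, 0 < tail V x) /\
  (limf_esup (fun x => (tail (conv_pow V 2) x / tail V x)%:E) +oo%R < +oo)%E.

Definition class_LOS gamma V : Prop := class_L gamma V /\ class_OS V.

Definition liminf_ratio_ge gamma V : Prop :=
  (\forall x \near +oo, 0 < tail V x) /\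
  forall t, 0 < t ->
    ((expR (gamma * t))%:E <=
      limf_einf (fun x => (tail V (x - t) / tail V x)%:E) +oo%R)%E.

End classes.

Section levy.
Context {R : realType}.
Implicit Types (ups : {measure set R -> \bar R}).

Definition levy_mass ups : R := fine (ups `]1%R, +oo[%classic).

(* A Borel measure on the open half-line is represented by its extension to
   R that vanishes on ]-oo, 0]. *)
Definition levy_measure ups : Prop :=
  [/\ ups `]-oo, 0%R]%classic = 0%E,
      (0 < ups `]1%R, +oo[%classic)%E,
      (ups `]1%R, +oo[%classic < +oo)%E &
      (\int[ups]_(y in `]0%R, 1%R]) y%:E < +oo)%E].

Definition infinitely_divisible (V : dist R) : Prop :=
  forall n : nat, (0 < n)%N -> exists Q : dist R,
    forall A : set R, measurable A -> V A = conv_pow Q n A.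

Definition id_with_levy_data (a : R) ups (V : dist R) : Prop :=
  [/\ infinitely_divisible V,
      V `]-oo, 0%R[%classic = 0%E &
      forall lam : R, 0 <= lam ->
        (\int[V]_(y in `[0%R, +oo[) (expR (- (lam * y)))%:E =
         expeR (- (a * lam)%:E
                - \int[ups]_(y in `]0%R, +oo[) (1 - expR (- (lam * y)))%:E))%E].

Definition levy_small ups : {measure set R -> \bar R} :=
  @mrestr _ R R `]0%R, 1%R]%classic ups (measurable_itv _).

Definition levy_spectral ups (F : dist R) : Prop :=
  forall x : R, F `]-oo, x]%classic =
    (if 1 < x then fine (ups `]1, x]%classic) / levy_mass ups else 0)%:E.

Definition compound_poisson (mu : R) (F V : dist R) : Prop :=
  forall x : R, V `]-oo, x]%classic =
    ((expR (- mu))%:E *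
      \sum_(0 <= k <oo) (conv_pow F k `]-oo, x]%classic * (mu ^+ k / k`!%:R)%:E))%E.

Definition levy_decomposition (a : R) ups (F H1 H2 H : dist R) : Prop :=
  [/\ id_with_levy_data a (levy_small ups) H1,
      compound_poisson (levy_mass ups) F H2 &
      forall A : set R, measurable A -> H A = conv_dist H1 H2 A].

End levy.

(* Main.v *)
Require Import Defs.
From HB Require Import structures.
From mathcomp Require Import all_boot all_order all_algebra.
From mathcomp Require Import all_classical all_reals all_analysis.
From mathcomp Require Import measurable_realfun.
From mathcomp Require Import ring lra.

Set Implicit Arguments.
Unset Strict Implicit.
Unset Printing Implicit Defensive.

Import Order.TTheory GRing.Theory Num.Theory.
Import numFieldNormedType.Exports.

Local Open Scope classical_set_scope.
Local Open Scope ring_scope.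

(** Write h for the tail of [H2], a_k for the tail of the k-fold convolution
    of [F], mu for the mass of the Levy measure beyond 1 and p_k for the Poisson
    weights of mean mu, so that h is the sum of the p_k a_k.  The
    argument works with this series and with [H] as the law of a sum of
    independent variables of laws [H1] and [H2], where [H1] and [F] live on the
    half-line.

    Comparison of [H] and [H2].  Always h <= tail [H].  Conversely, as the tail
    of [H1] is at most eps h beyond some A, splitting on whether the summand
    of law [H1] exceeds A gives
    tail H (x) <= eps tail (H2 * H2) (x) + h (x - A)
    ([tail_conv_le]).  The first term is absorbed because H is in OS, and
    the shift costs a constant factor because H is in L(gamma).  Hence the two
    tails are comparable ([tail_conv_comparable]) and [H2] is in OS.

    Truncation of the series.  Since k p_k = mu p_(k-1), the terms of index
    k > n add up to at most mu / (n + 1) times the tail of F * H2, and the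
    latter is at most tail (H2 * H2) / p_1, which is O(h).  So, uniformly in x,
    the remainders of the series are a small fraction of h
    ([remainder_small]).  Consequently h = O(a_n) for all large n, and the
    lower bound on the ratios of the a_k passes to h.

    Upper bounds on the ratios.  The difference
    tail V (x - t) - exp(gamma t) tail V (x) is, up to negligible terms,
    nonnegative for each member V of a mixture, while for the mixture itself,
    when it belongs to L(gamma), it is negligible.  So it is negligible for
    every member that carries a fixed proportion of the mixture.  For the
    discrete mixture h this yields L(gamma) for every convolution power with
    h = O(a_n) ([component_upper]).  For H, a mixture of translates
    of [H2], one needs in addition to pass from an average over translates to a
    single point; this is where monotonicity of tails enters
    ([deconvolution_upper]).

    Roots in OS.  If a convolution power of order l is in OS, then all a_N are
    O(a_l) ([OS_pow_bound]), so h = O(a_n) for every n >= l and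
    the previous step applies to each of them.

    When gamma > 0 the lattice case of L(gamma) has to be excluded: a lattice
    tail is constant on intervals, so its ratios equal 1 at arbitrarily large
    points ([ratio_lower_not_lattice], [conv_not_lattice]). *)

(** * Tails of distributions and of convolutions *)

Section tails.
Context {R : realType}.
Implicit Types (V W : dist R) (x y t : R).

Lemma tailE V x : V `]x, +oo[%classic = (tail V x)%:E.
Proof. by rewrite fineK// fin_num_measure. Qed.

Lemma tail_ge0 V x : 0 <= tail V x.
Proof. by rewrite fine_ge0. Qed.

Lemma tail_le1 V x : tail V x <= 1.
Proof. by rewrite -lee_fin -tailE probability_le1. Qed.

Lemma tail_noninc V x y : x <= y -> tail V y <= tail V x.
Proof.
move=> xy; rewrite -lee_fin -!tailE le_measure ?inE//.
by apply: subset_itvr; rewrite bnd_simp.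
Qed.

Lemma cdfE V x : V `]-oo, x]%classic = (1 - tail V x)%:E.
Proof.
rewrite EFinB -tailE -probability_setC//; congr (V _).
by rewrite setCitvr.
Qed.

Lemma measurable_tail_sub V x : measurable_fun setT (fun y => tail V (x - y)).
Proof.
by apply: nondecreasing_measurable => // y z yz; apply: tail_noninc; lra.
Qed.

Lemma integrable_tail_sub V W x :
  V.-integrable setT (EFin \o (fun y => tail W (x - y))).
Proof.
apply: measurable_bounded_integrable => //.
- by rewrite -ge0_fin_numE// fin_num_measure.
- exact: measurable_tail_sub.
- exists 1; split => // M M1 y _ /=.
  by rewrite ger0_norm ?tail_ge0// (le_trans (tail_le1 _ _))// ltW.
Qed.

Lemma tail_conv V W x : tail (conv_dist V W) x = \int[V]_y tail W (x - y).
Proof.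
rewrite /tail /conv_dist /distribution /pushforward/= /product_measure1.
congr fine; apply: eq_integral => y _ /=; rewrite -tailE; congr (W _).
apply/seteqP; split => z /=; rewrite /xsection/= inE/= /Defs.add_pair/= !in_itv/= !andbT; lra.
Qed.

(** By Tonelli, both sides integrate the indicator of x < y + z over the
    product of [V] and [W]. *)
Lemma tail_convC V W x : tail (conv_dist V W) x = tail (conv_dist W V) x.
Proof.
rewrite !tail_conv /Rintegral; congr fine.
pose A := [set z : R * R | x < z.1 + z.2].
have mA : measurable A.
  have := @Defs.measurable_add_pair R measurableT `]x, +oo[%classic.
  rewrite setTI => /(_ (measurable_itv _)); congr measurable.
  by apply/seteqP; split => z /=; rewrite /Defs.add_pair in_itv/= andbT.
pose f (z : R * R) : \bar R := (\1_A z)%:E.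
have mf : measurable_fun setT f.
  by apply/measurable_EFinP; exact: measurable_indic.
have ind (U : dist R) (g : R -> R * R) y :
    measurable_fun setT g -> (forall z, A (g z) <-> x - y < z) ->
    (\int[U]_z f (g z) = (tail U (x - y))%:E)%E.
  move=> mg gA; rewrite -tailE.
  rewrite -[LHS]/((\int[U]_z (\1_(g @^-1` A) z)%:E)%E) integral_indic//.
    rewrite setIT; congr (U _); apply/seteqP.
    by split => z /=; rewrite in_itv/= andbT => /gA.
  by rewrite -[X in measurable X]setTI; exact: mg.
have l1 y : (\int[W]_z f (y, z) = (tail W (x - y))%:E)%E.
  by apply: (ind W (pair y)) => // z; rewrite /A/=; split; lra.
have l2 y : (\int[V]_z f (z, y) = (tail V (x - y))%:E)%E.
  by apply: (ind V (pair^~ y)) => // z; rewrite /A/=; split; lra.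
under eq_integral do rewrite -l1.
under [in RHS]eq_integral do rewrite -l2.
by apply: (fubini_tonelli f) => // z; rewrite lee_fin.
Qed.

Lemma tail_conv1 V x : tail (conv_pow V 1) x = tail V x.
Proof.
rewrite /= tail_convC tail_conv /Rintegral integral_dirac//.
  by rewrite diracE mem_set//= mul1r subr0.
exact: (measurable_int _ (integrable_tail_sub V V x)).
Qed.

Lemma le_tail_conv V W W' x : (forall u, tail W u <= tail W' u) ->
  tail (conv_dist V W) x <= tail (conv_dist V W') x.
Proof.
move=> WW'; rewrite !tail_conv.
by apply: le_Rintegral => //; exact: integrable_tail_sub.
Qed.

Lemma tail_conv_pow2 V x : tail (conv_pow V 2) x = tail (conv_dist V V) x.
Proof.
rewrite [LHS]tail_conv [RHS]tail_conv.
by apply: eq_Rintegral => y _; rewrite tail_conv1.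
Qed.

Lemma integrableBR V (f g : R -> R) :
  V.-integrable setT (EFin \o f) -> V.-integrable setT (EFin \o g) ->
  V.-integrable setT (EFin \o (fun y => f y - g y)).
Proof. by move=> intf intg; have := integrableB measurableT intf intg. Qed.

Lemma integrableDR V (f g : R -> R) :
  V.-integrable setT (EFin \o f) -> V.-integrable setT (EFin \o g) ->
  V.-integrable setT (EFin \o (fun y => f y + g y)).
Proof. by move=> intf intg; have := integrableD measurableT intf intg. Qed.

Lemma integrableZR V (c : R) (f : R -> R) :
  V.-integrable setT (EFin \o f) ->
  V.-integrable setT (EFin \o (fun y => c * f y)).
Proof. by move=> intf; have := integrableZl measurableT c intf. Qed.

Lemma integrable_cstR V (c : R) : V.-integrable setT (EFin \o cst c).
Proof. exact: finite_measure_integrable_cst. Qed.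

Lemma integrable_indicR V (A : set R) : measurable A ->
  V.-integrable setT (EFin \o (\1_A : R -> R)).
Proof. by move=> mA; exact: integrable_indic. Qed.

Lemma Rintegral_indic V (A : set R) : measurable A ->
  \int[V]_y \1_A y = fine (V A).
Proof. by move=> mA; rewrite /Rintegral integral_indic// setIT. Qed.

Lemma tail_indic V x : tail V x = \int[V]_y \1_(`]x, +oo[%classic) y.
Proof. by rewrite Rintegral_indic. Qed.

Lemma Rintegral_cst1 V (c : R) : \int[V]_y (cst c y) = c.
Proof.
rewrite Rintegral_cst// -[RHS]mulr1; congr (_ * _).
exact: (congr1 fine (probability_setT V)).
Qed.

(** Adding a nonnegative variable can only increase the tail. *)
Lemma tail_conv_ge V W x : V `]-oo, 0%R[%classic = 0%E ->
  tail W x <= tail (conv_dist V W) x.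
Proof.
move=> V0; rewrite tail_conv.
have := Rintegral_indic V (measurable_itv `]-oo, 0%R[); rewrite V0/= => i0.
(* Subtracting the indicator of the null set of negative y changes no
   integral and makes the comparison of the integrands pointwise. *)
have -> : tail W x = \int[V]_y (cst (tail W x) y - \1_(`]-oo, 0%R[%classic) y).
  rewrite RintegralB//.
  - by rewrite i0 Rintegral_cst1 subr0.
  - exact: finite_measure_integrable_cst.
  - exact: integrable_indicR.
apply: le_Rintegral => //.
- apply: integrableBR; first exact: finite_measure_integrable_cst.
  exact: integrable_indicR.
- exact: integrable_tail_sub.
move=> y _ /=; rewrite indicE; case: (ltP y 0) => y0.
  by rewrite mem_set/= ?in_itv//= (le_trans _ (tail_ge0 _ _))// subr_le0 tail_le1.
rewrite memNset/= ?in_itv/= ?subr0; last by apply/negP; rewrite -leNgt.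
by apply: tail_noninc; lra.
Qed.

End tails.

(** * Ratio conditions and the classes L(gamma) and OS *)

Section ratios.
Context {R : realType}.
Implicit Types (V W : dist R) (f : R -> R) (x y t q r gamma : R).

(** The condition that the lower limit of f (x - t) / f x at infinity is
    at least [r], without division, so that it makes sense where [f] vanishes. *)
Definition ratio_lower f t r :=
  forall q, q < r -> \forall x \near +oo, q * f x <= f (x - t).

Definition ratio_upper f t r :=
  forall q, r < q -> \forall x \near +oo, f (x - t) <= q * f x.

Lemma near_pinftyP (P : set R) :
  (\forall x \near +oo, P x) <-> exists M, forall x, M < x -> P x.
Proof.
split=> [[M [_ MP]]|[M MP]]; first by exists M.
by exists M; split => //; exact: num_real.
Qed.

Lemma near_pinftyD (P : set R) (s : R) :
  (\forall x \near +oo, P x) -> \forall x \near +oo, P (x + s).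
Proof.
move=> /near_pinftyP[M MP]; apply/near_pinftyP; exists (M - s) => x Mx.
by apply: MP; lra.
Qed.

Lemma tail_gt0 V : (\forall x \near +oo, 0 < tail V x) ->
  forall x, 0 < tail V x.
Proof.
move=> /near_pinftyP[M MP] x.
apply: (lt_le_trans (MP (Num.max x M + 1) _)).
  by rewrite ltr_pwDr// le_max lexx orbT.
by apply: tail_noninc; rewrite ler_wpDr// le_max lexx.
Qed.

Lemma liminf_ratio_ge_lower gamma V : liminf_ratio_ge gamma V ->
  (forall x, 0 < tail V x) /\
  forall t, 0 < t -> ratio_lower (tail V) t (expR (gamma * t)).
Proof.
move=> [/tail_gt0 V0 Vinf]; split=> // t t0 q qt.
have : (q%:E < limf_einf (fun x => (tail V (x - t) / tail V x)%:E) +oo%R)%E.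
  by apply: lt_le_trans (Vinf t t0); rewrite lte_fin.
rewrite limf_einfE => /ereal_sup_gt[_ [A nA <-]] qA.
apply: filterS nA => x Ax.
rewrite -ler_pdivlMr// -lee_fin; apply: (le_trans (ltW qA)).
by apply: ereal_inf_lbound; exists x.
Qed.

Lemma class_OS_bound V : class_OS V ->
  (forall x, 0 < tail V x) /\
  exists2 C, 0 < C &
    \forall x \near +oo, tail (conv_dist V V) x <= C * tail V x.
Proof.
move=> [/tail_gt0 V0 Vsup]; split=> //.
move: Vsup; rewrite limf_esupE => /ereal_inf_lt[_ [A nA <-]] Aoo.
have bnd x : A x -> ((tail (conv_pow V 2) x / tail V x)%:E <=
    ereal_sup [set (tail (conv_pow V 2) x / tail V x)%:E | x in A])%E.
  by move=> Ax; apply: ereal_sup_ubound; exists x.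
move: bnd Aoo; case: (ereal_sup _) => [C|//|] bnd _; last first.
  exists 1 => //; apply: filterS nA => x /bnd.
  by rewrite leeNy_eq.
exists (Num.max C 1); first by rewrite lt_max ltr01 orbT.
apply: filterS nA => x /bnd.
rewrite lee_fin ler_pdivrMr// tail_conv_pow2 => /le_trans; apply.
by rewrite ler_wpM2r ?tail_ge0// le_max lexx.
Qed.

Lemma bound_class_OS V C : (forall x, 0 < tail V x) ->
  (\forall x \near +oo, tail (conv_dist V V) x <= C * tail V x) -> class_OS V.
Proof.
move=> V0 VC; split; first exact: nearW.
rewrite limf_esupE; apply: (@le_lt_trans _ _ C%:E); last by rewrite ltry.
apply: ereal_inf_le; eexists.
  by exists [set x | tail (conv_dist V V) x <= C * tail V x].
apply: ge_ereal_sup => _ [x /= xC <-].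
by rewrite lee_fin ler_pdivrMr// tail_conv_pow2.
Qed.

(** Below any threshold the tail is bounded away from zero, so the asymptotic
    bound extends to the whole line at the cost of a larger constant. *)
Lemma class_OS_global V : class_OS V ->
  exists2 C, 0 < C & forall x, tail (conv_dist V V) x <= C * tail V x.
Proof.
move=> /class_OS_bound[V0 [C C0 /near_pinftyP[M MP]]].
have iV : 0 < (tail V M)^-1 by rewrite invr_gt0.
exists (C + (tail V M)^-1); first by rewrite addr_gt0.
move=> x; rewrite mulrDl; case: (ltP M x) => [/MP|xM].
  by move=> /le_trans; apply; rewrite lerDl mulr_ge0 ?tail_ge0// ltW.
apply: (le_trans (tail_le1 _ _)); apply: ler_wpDl.
  by rewrite mulr_ge0 ?tail_ge0// ltW.
by rewrite mulrC ler_pdivlMr// mul1r tail_noninc.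
Qed.

(** There is no mass strictly between consecutive lattice points. *)
Lemma lattice_tail V c d (m : int) s : concentrated_on_lattice V c d ->
  0 <= s < d -> tail V (c + d * m%:~R + s) = tail V (c + d * m%:~R).
Proof.
move=> [d0 V1] /andP[s0 sd]; set L := (X in V X = _) in V1.
set x := c + d * m%:~R.
have mL : measurable L.
  apply: countable_measurable => //.
  exact: (card_le_trans (card_image_le _ _) (countableP _)).
apply/EFin_inj; rewrite -!tailE.
have -> : `]x, +oo[%classic = `]x + s, +oo[%classic `|` `]x, x + s]%classic.
  apply/seteqP; split => z /=; rewrite !in_itv/= !andbT.
    by case: (leP z (x + s)) => ? ?; [right; apply/andP|left].
  by case=> [|/andP[]] ? //; lra.
have V0 : V `]x, x + s]%classic = 0%E.
  have : (V (~` L) = 0)%E by rewrite probability_setC// V1 subee.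
  apply: subset_measure0 => //; first exact: measurableC.
  move=> z /=; rewrite in_itv/= => /andP[xz zs] [k _ kz].
  move: xz zs; rewrite -kz /x => xz zs.
  have mk : (m < k)%R.
    by rewrite -(ltr_int R) -(ltr_pM2l d0); lra.
  have : m + 1 <= k by rewrite lezD1.
  rewrite -(ler_int R) -(ler_pM2l d0) intrD mulrDr mulr1; lra.
by rewrite measureU0//.
Qed.

(** With d the step of the lattice, the shift by d / 2 from the midpoint of a
    gap does not change the tail, however far the gap. *)
Lemma ratio_lower_not_lattice V : (forall x, 0 < tail V x) ->
  (forall t, 0 < t -> exists2 r, 1 < r & ratio_lower (tail V) t r) ->
  ~ lattice V.
Proof.
move=> V0 low [c [d cd]]; have d0 : 0 < d by case: cd.
have [|r r1 lr] := low (d / 2); first by rewrite divr_gt0.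
have /lr/near_pinftyP[M MP] : (1 + r) / 2 < r by lra.
have [n Mn] : exists n : nat, M < c + d * n%:R.
  exists (Num.truncn (`|M - c| / d)).+1.
  have := truncnS_gt (`|M - c| / d); rewrite ltr_pdivrMr// => h.
  by have := ler_norm (M - c); lra.
have /= := MP (c + d * n%:R + d / 2).
rewrite addrK -{2 3}[n%:R]/((n%:Z)%:~R) (lattice_tail _ cd)//; last by lra.
have := V0 (c + d * n%:Z%:~R) => V0n h.
have /h : M < c + d * n%:R + d / 2 by lra.
by nra.
Qed.

(** For [gamma > 0] the lower bounds already rule out lattice distributions, so
    the clause of [class_L] on lattice spans is vacuous. *)
Lemma class_L_intro gamma V : (forall x, 0 < tail V x) -> 0 <= gamma ->
  (forall t, 0 < t -> ratio_lower (tail V) t (expR (gamma * t))) ->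
  (forall t, 0 < t -> ratio_upper (tail V) t (expR (gamma * t))) ->
  class_L gamma V.
Proof.
move=> V0 g0 low upp; split=> // [_ t t0|g1 d [[c cd] _]]; last first.
  exfalso; apply: (ratio_lower_not_lattice V0 _ (ex_intro _ c (ex_intro _ d cd))).
  move=> t t0; exists (expR (gamma * t)); last exact: low.
  by rewrite expR_gt1 mulr_gt0.
apply/cvgrPdist_le => e e0; near=> x.
have ->: tail V (x - t) = tail V (x - t) / tail V x * tail V x.
  by rewrite divfK// gt_eqF.
rewrite mulfK ?gt_eqF// ler_distlC; apply/andP; split.
  rewrite ler_pdivlMr//; near: x; apply: low => //; lra.
by rewrite ler_pdivrMr//; near: x; apply: upp => //; lra.
Unshelve. all: by end_near. Qed.

Lemma class_L_elim gamma V : class_L gamma V -> (gamma = 0 \/ ~ lattice V) ->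
  forall t, 0 < t -> ratio_lower (tail V) t (expR (gamma * t)) /\
    ratio_upper (tail V) t (expR (gamma * t)).
Proof.
move=> [V0 lim _] nl t t0; have {}lim := lim nl t t0.
split=> q qt.
  have /cvgrPdist_le/(_ (expR (gamma * t) - q)) := lim.
  rewrite subr_gt0 => /(_ qt); apply: filterS => x.
  rewrite ler_distlC => /andP[+ _].
  by rewrite opprB addrCA subrr addr0 ler_pdivlMr.
have /cvgrPdist_le/(_ (q - expR (gamma * t))) := lim.
rewrite subr_gt0 => /(_ qt); apply: filterS => x.
rewrite ler_distlC => /andP[_].
by rewrite addrCA subrr addr0 ler_pdivrMr.
Qed.

End ratios.

(** * Tails of compound Poisson distributions *)

Section compound_poisson_tails.
Context {R : realType}.
Variables (mu : R) (F V : dist R).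
Hypotheses (mu0 : 0 < mu) (F0 : F `]-oo, 0%R[%classic = 0%E).
Hypothesis VE : compound_poisson mu F V.

Definition poisson_weight (m : R) (k : nat) : R := expR (- m) * (m ^+ k / k`!%:R).

Local Notation p := (poisson_weight mu).
Local Notation a k := (tail (conv_pow F k)).
Local Notation S n x := (\sum_(0 <= k < n) p k * a k x).

Lemma poisson_weight_gt0 k : 0 < p k.
Proof.
by rewrite mulr_gt0 ?expR_gt0// divr_gt0 ?exprn_gt0// ltr0n fact_gt0.
Qed.

Lemma poisson_weightS k : p k.+1 = p k * (mu / k.+1%:R).
Proof.
rewrite /poisson_weight factS exprS natrM.
have k0 : k.+1%:R != 0 :> R by rewrite pnatr_eq0.
have kf0 : k`!%:R != 0 :> R by rewrite pnatr_eq0 -lt0n fact_gt0.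
by field; rewrite kf0 addrC natr1 k0.
Qed.

Lemma tail_conv_pow_le k l x : (k <= l)%N -> a k x <= a l x.
Proof.
elim: l => [|l IH]; first by rewrite leqn0 => /eqP->.
rewrite leq_eqVlt => /predU1P[->//|]; rewrite ltnS => /IH /le_trans; apply.
exact: tail_conv_ge.
Qed.

(** The definition of a compound Poisson law is by distribution functions; the
    weights have sum 1, so the complements satisfy the same expansion. *)
Lemma cvg_compound_poisson x : S n x @[n --> \oo] --> tail V x.
Proof.
pose u k : R := (1 - a k x) * (mu ^+ k / k`!%:R).
pose v := exp_coeff mu.
have u0 k : 0 <= u k.
  by rewrite mulr_ge0 ?subr_ge0 ?tail_le1// divr_ge0 ?exprn_ge0 ?ler0n// ltW.
have := VE x; rewrite cdfE.
under eq_eseriesr do rewrite cdfE -EFinM.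
move=> Vx.
have sumE : (\sum_(0 <= k <oo) (u k)%:E = (expR mu * (1 - tail V x))%:E)%E.
  rewrite EFinM Vx muleA -EFinM expRxMexpNx_1 mul1e //.
have cu : series u @ \oo --> expR mu * (1 - tail V x).
  have : (\sum_(0 <= k < n) (u k)%:E)%E @[n --> \oo] -->
      (expR mu * (1 - tail V x))%:E.
    rewrite -sumE; apply: is_cvg_nneseries => k _ _; by rewrite lee_fin.
  move=> /fine_cvgP[_]; apply: cvg_trans; apply: near_eq_cvg.
  by near=> n; rewrite /= sumEFin.
have cv : series v @ \oo --> expR mu by exact: is_cvg_series_exp_coeff.
have := cvgMl_tmp (a := expR (- mu)) (cvgB cv cu).
have -> : expR (- mu) * (expR mu - expR mu * (1 - tail V x)) = tail V x.
  have := expRxMexpNx_1 mu => h; transitivity (expR mu * expR (- mu) * tail V x); first ring.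
  by rewrite h mul1r.
move=> lim.
suff -> : (fun n => S n x) =
    (fun n => expR (- mu) * (series v \- series u) n) by exact: lim.
apply/funext => n; rewrite /= /series/= -sumrB mulr_sumr; apply: eq_bigr => k _.
by rewrite /u /v /exp_coeff/= /poisson_weight; ring.
Unshelve. all: by end_near. Qed.

Lemma partial_compound_poisson_le n x : S n x <= tail V x.
Proof.
have /cvg_lim <- // := @cvg_compound_poisson x.
apply: (nondecreasing_cvgn_le (u_ := fun n => S n x)).
  apply/nondecreasing_seqP => k; rewrite big_nat_recr//= lerDl.
  by rewrite mulr_ge0 ?tail_ge0// ltW// poisson_weight_gt0.
by apply/cvg_ex; exists (tail V x); exact: cvg_compound_poisson.
Qed.

Lemma poisson_weight_tail_le k x : p k * a k x <= tail V x.
Proof.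
apply: le_trans (partial_compound_poisson_le k.+1 x).
rewrite big_nat_recr//= lerDr sumr_ge0// => i _.
by rewrite mulr_ge0 ?tail_ge0// ltW// poisson_weight_gt0.
Qed.

Lemma Rintegral_partial n x :
  F.-integrable setT (EFin \o (fun y => S n (x - y))) /\
  \int[F]_y S n (x - y) = \sum_(0 <= k < n) p k * a k.+1 x.
Proof.
elim: n => [|n [IHi IHe]].
  split.
    by under eq_fun do rewrite big_geq//; exact: integrable_cstR.
  rewrite big_geq//; under eq_Rintegral do rewrite big_geq//.
  exact: Rintegral_cst1.
have intn := integrableZR (p n) (integrable_tail_sub F (conv_pow F n) x).
have E y : S n.+1 y = S n y + p n * a n y by rewrite big_nat_recr.
split; first by under eq_fun do rewrite E; exact: integrableDR.
under eq_Rintegral do rewrite E.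
rewrite RintegralD// IHe RintegralZl//; last exact: integrable_tail_sub.
by rewrite big_nat_recr//= tail_conv.
Qed.

(** The partial sums bound the tail of [V] from below, and convolving with [F]
    raises the order of each power by one. *)
Lemma sum_shift_le_conv n x :
  \sum_(0 <= k < n) p k * a k.+1 x <= tail (conv_dist F V) x.
Proof.
have [ii <-] := Rintegral_partial n x.
rewrite tail_conv; apply: le_Rintegral => //; first exact: integrable_tail_sub.
by move=> y _; exact: partial_compound_poisson_le.
Qed.

(** For k > n the weight of index k is mu / k <= mu / (n + 1) times the one of
    index k - 1, so the remainder is dominated by the series of F * V. *)
Lemma compound_poisson_remainder n x :
  tail V x <= S n.+1 x + mu / n.+1%:R * tail (conv_dist F V) x.
Proof.
apply: (cvgr_to_le (@cvg_compound_poisson x)).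
apply: filterS (nbhs_infty_gt n) => m nm.
rewrite (big_cat_nat (n := n.+1))//= lerD2l; move: nm; case: m => // m nm.
rewrite big_add1/=.
apply: (le_trans (y := mu / n.+1%:R * \sum_(n <= k < m) p k * a k.+1 x)).
  rewrite mulr_sumr; apply: ler_sum_nat => k /andP[nk _].
  rewrite poisson_weightS mulrAC [leRHS]mulrCA -mulrA ler_pM2l ?poisson_weight_gt0//.
  rewrite mulrC; apply: ler_wpM2r; first exact: tail_ge0.
  by rewrite ler_pM2l// lef_pV2 ?posrE ?ltr0n// ler_nat.
apply: ler_wpM2l; first by rewrite divr_ge0 ?ler0n// ltW.
apply: le_trans (sum_shift_le_conv m x).
rewrite [leRHS](big_cat_nat (n := n))//= lerDr.
by apply: sumr_ge0 => k _; rewrite mulr_ge0 ?tail_ge0// ltW// poisson_weight_gt0.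
Qed.

(** One of the two factors [V] is replaced by the term of order one in its
    expansion. *)
Lemma conv_spectral_le x : p 1 * tail (conv_dist F V) x <= tail (conv_dist V V) x.
Proof.
rewrite tail_convC [leLHS](_ : _ = \int[V]_y (p 1 * tail F (x - y))).
  rewrite [leRHS]tail_conv; apply: le_Rintegral => //.
  - by apply: integrableZR; exact: integrable_tail_sub.
  - exact: integrable_tail_sub.
  - by move=> y _; have := poisson_weight_tail_le 1 (x - y); rewrite tail_conv1.
by rewrite RintegralZl ?tail_conv//; exact: integrable_tail_sub.
Qed.

(** Every term of the expansion is nonincreasing, so a decrease of the tail of
    [F] forces a proportional decrease of the tail of [V]. *)
Lemma compound_poisson_increments x y : x <= y ->
  p 1 * (tail F x - tail F y) <= tail V x - tail V y.
Proof.
move=> xy.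
apply: (cvgr_to_ge (cvgB (@cvg_compound_poisson x) (@cvg_compound_poisson y))).
apply: filterS (nbhs_infty_gt 1) => n n1.
have term k : 0 <= p k * a k x - p k * a k y.
  by rewrite -mulrBr mulr_ge0 ?subr_ge0 ?tail_noninc// ltW// poisson_weight_gt0.
rewrite -[leRHS]/(S n x - S n y).
rewrite -sumrB (bigD1_seq 1%N) ?iota_uniq//= ?mem_index_iota//.
by rewrite -(tail_conv1 F x) -(tail_conv1 F y) mulrBr lerDl sumr_ge0.
Qed.

End compound_poisson_tails.

(** * Transfer of tail ratios through convolutions and mixtures *)

Section conv_bounds.
Context {R : realType}.
Implicit Types (U V W H : dist R) (x t q r gamma : R).

Lemma le_tail_convZ V W W' c x : (forall u, tail W u <= c * tail W' u) ->
  tail (conv_dist V W) x <= c * tail (conv_dist V W') x.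
Proof.
move=> WW'; rewrite !tail_conv -RintegralZl//; last exact: integrable_tail_sub.
apply: le_Rintegral => //; first exact: integrable_tail_sub.
by apply: integrableZR; exact: integrable_tail_sub.
Qed.

Lemma le_tail_conv_selfZ V W c x : 0 <= c ->
  (forall u, tail W u <= c * tail V u) ->
  tail (conv_dist W W) x <= c ^+ 2 * tail (conv_dist V V) x.
Proof.
move=> c0 WV; apply: le_trans (le_tail_convZ _ _ WV) _.
by rewrite tail_convC expr2 -mulrA ler_wpM2l// le_tail_convZ.
Qed.

(** Condition on the summand y of law [V]: if the other one has to exceed
    x - y >= A, the hypothesis applies; otherwise y > x - A. *)
Lemma tail_conv_le U V e A x : 0 <= e ->
  (forall u, A <= u -> tail U u <= e * tail V u) ->
  tail (conv_dist U V) x <= e * tail (conv_dist V V) x + tail V (x - A).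
Proof.
move=> e0 UV; rewrite tail_convC !tail_conv.
pose B : set R := `]x - A, +oo[%classic.
have iV := integrable_tail_sub V V x.
have iB : V.-integrable setT (EFin \o (\1_B : R -> R)) by exact: (integrable_indicR _ (measurable_itv _)).
rewrite (tail_indic V (x - A)) -/B.
rewrite -RintegralZl// -RintegralD//; last exact: integrableZR.
apply: le_Rintegral => //; first exact: integrable_tail_sub.
  by apply: integrableDR => //; exact: integrableZR.
move=> y _; rewrite indicE; case: (ltP (x - A) y) => yA.
  rewrite mem_set/=; last by rewrite /B/= in_itv/= yA.
  by rewrite (le_trans (tail_le1 _ _))// lerDr mulr_ge0 ?tail_ge0.
rewrite memNset/= ?addr0; first by apply: UV; lra.
by rewrite /B/= in_itv/= andbT; apply/negP; rewrite -leNgt.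
Qed.

(** Countably many intervals of length [b] cover the half-line, so they cannot
    all be null. *)
Lemma exists_itv_mass U b : U `]-oo, 0%R[%classic = 0%E -> 0 < b ->
  exists2 c, 0 <= c & 0 < fine (U `[c, c + b[%classic).
Proof.
move=> U0 b0; apply: contrapT => nex.
have null c : 0 <= c -> U `[c, c + b[%classic = 0%E.
  move=> c0; apply/eqP; apply: contrapT => /negP Uc; apply: nex; exists c => //.
  rewrite fine_gt0// lt0e Uc measure_ge0/=.
  by rewrite -ge0_fin_numE// fin_num_measure.
have : U.-negligible (`]-oo, 0%R[%classic `|`
    \bigcup_(k in setT) `[k%:R * b, k%:R * b + b[%classic).
  apply: negligibleU; first by apply/negligibleP.
  apply: negligible_bigcup => k; apply/negligibleP => //.
  by apply: null; rewrite mulr_ge0// ltW.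
have -> : `]-oo, 0%R[%classic `|`
    \bigcup_(k in setT) `[k%:R * b, k%:R * b + b[%classic = [set: R].
  apply/seteqP; split => // y _; case: (ltP y 0) => y0.
    by left; rewrite /= in_itv.
  right; exists (Num.truncn (y / b)) => //=; rewrite in_itv/=.
  have yb : 0 <= y / b by rewrite divr_ge0// ltW.
  have := truncn_itv yb => /andP[].
  by rewrite ler_pdivlMr// ltr_pdivrMr// -natr1 mulrDl mul1r => -> ->.
move=> /negligibleP => /(_ measurableT) UT.
by have := probability_setT U => /eqP; rewrite [X in X == _]UT eq_sym onee_eq0.
Qed.

End conv_bounds.

Section transfer.
Context {R : realType}.
Implicit Types (U V W H : dist R) (K t q r gamma : R).

(** With e = 1 / (2 C), the first term in the bound of [tail_conv_le] is at
    most half of the tail of [H], whence tail H (x) <= 2 tail V (x - A); the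
    shift by A is then moved to [H], whose ratios are under control. *)
Lemma tail_conv_comparable U V H gamma :
  U `]-oo, 0%R[%classic = 0%E ->
  (forall x, tail H x = tail (conv_dist U V) x) ->
  (forall e, 0 < e -> \forall x \near +oo, tail U x <= e * tail V x) ->
  (exists2 C, 0 < C &
    \forall x \near +oo, tail (conv_dist H H) x <= C * tail H x) ->
  (forall t, 0 < t -> ratio_upper (tail H) t (expR (gamma * t))) ->
  exists2 K, 0 < K & \forall x \near +oo, tail H x <= K * tail V x.
Proof.
move=> U0 HE UV [C C0 HH] Hup.
have VH u : tail V u <= 1 * tail H u by rewrite mul1r HE tail_conv_ge.
have e0 : 0 < (2 * C)^-1 by rewrite invr_gt0 mulr_gt0.
have /near_pinftyP[M UM] := UV _ e0.
pose A := Num.max M 0 + 1.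
have MA : M < A by rewrite /A ltr_pwDr// le_max lexx.
have A0 : 0 < A by rewrite /A ltr_wpDl// le_max lexx orbT.
exists (2 * (expR (gamma * A) + 1)).
  by rewrite mulr_gt0// addr_gt0// expR_gt0.
have Hsh : \forall x \near +oo, tail H (x + A - A) <= (expR (gamma * A) + 1) * tail H (x + A).
  by apply: (near_pinftyD (P := fun x => _ (x - A) <= _ * _ x)); apply: Hup => //; lra.
have Hcmp : \forall x \near +oo, tail (conv_dist H H) (x + A) <= C * tail H (x + A).
  exact: (near_pinftyD (P := fun x => tail _ x <= C * tail H x)).
near=> x.
have h1 : tail H (x + A - A) <= (expR (gamma * A) + 1) * tail H (x + A) by near: x.
have h2 : tail (conv_dist H H) (x + A) <= C * tail H (x + A) by near: x.
rewrite addrK in h1.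
have h3 : tail H (x + A) <= (2 * C)^-1 * tail (conv_dist V V) (x + A) + tail V x.
  rewrite HE -[X in tail V X](addrK A); apply: tail_conv_le; first exact: ltW.
  by move=> u Au; apply: UM; exact: lt_le_trans Au.
have h4 := @le_tail_conv_selfZ _ _ _ 1 (x + A) ler01 VH.
rewrite expr1n mul1r in h4.
have h5 : (2 * C)^-1 * tail (conv_dist V V) (x + A) <= tail H (x + A) / 2.
  rewrite mulrC ler_pdivrMr ?mulr_gt0//; apply: (le_trans h4); apply: (le_trans h2); lra.
have h6 : tail H (x + A) <= 2 * tail V x by lra.
apply: (le_trans h1); rewrite -mulrA mulrCA.
by rewrite ler_wpM2l// addr_ge0// expR_ge0.
Unshelve. all: by end_near. Qed.

(** The function [g] is the mixture of the [a k] with weights [c k], and [h] a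
    reference scale for which the remainders of the mixture are uniformly small.
    The ratio bounds for finitely many components suffice: they hold jointly
    for large x, and the remaining ones only contribute an error of order
    e * h. *)
Lemma mixture_lower (t r : R) (c : nat -> R) (a : nat -> R -> R) (g h : R -> R) :
  0 <= r -> (forall k, 0 <= c k) -> (forall k x, 0 <= a k x) ->
  (forall k, ratio_lower (a k) t r) ->
  (forall n x, \sum_(0 <= k < n) c k * a k x <= g x) ->
  (forall x, g x <= h x) ->
  (forall e, 0 < e -> exists n, \forall x \near +oo,
    g x <= \sum_(0 <= k < n) c k * a k x + e * h x) ->
  forall e, 0 < e -> \forall x \near +oo, r * g x - e * h x <= g (x - t).
Proof.
move=> r0 c0 a0 lo Sg gh rem e e0.
pose d := e / (2 * (r + 1)).
have d0 : 0 < d by rewrite divr_gt0// mulr_gt0//; lra.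
have [n nP] := rem _ d0.
have SP : \forall x \near +oo, (r - e / 2) * (\sum_(0 <= k < n) c k * a k x) <=
    \sum_(0 <= k < n) c k * a k (x - t).
  elim: n {nP} => [|n IH]; first by apply: nearW => x; rewrite !big_geq// mulr0.
  have := lo n (r - e / 2) _; rewrite ltrBlDr ltrDl divr_gt0// => /(_ isT).
  apply: filterS2 IH => x IH an; rewrite !big_nat_recr//= mulrDr lerD//.
  by rewrite mulrCA ler_wpM2l.
near=> x.
have nx : g x <= \sum_(0 <= k < n) c k * a k x + d * h x by near: x.
have Sx : (r - e / 2) * (\sum_(0 <= k < n) c k * a k x) <=
    \sum_(0 <= k < n) c k * a k (x - t) by near: x.
have S0 : 0 <= \sum_(0 <= k < n) c k * a k x.
  by apply: sumr_ge0 => k _; rewrite mulr_ge0.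
have := Sg n x; have := gh x; have := Sg n (x - t).
move: (\sum_(0 <= k < n) c k * a k x) nx Sx S0 => s nx Sx s0 st ghx sg.
have h0 : 0 <= h x by exact: le_trans (le_trans s0 sg) ghx.
have rd : r * d <= e / 2.
  rewrite /d mulrA ler_pdivrMr ?mulr_gt0//; last lra.
  by nra.
have l1 : r * g x <= r * s + r * d * h x by rewrite -mulrA -mulrDr ler_wpM2l.
have l2 : r * d * h x <= e / 2 * h x by rewrite ler_wpM2r.
have l3 : e / 2 * s <= e / 2 * h x by rewrite ler_wpM2l; lra.
by lra.
Unshelve. all: by end_near. Qed.

(** If f (x - t) exceeded r f (x) by a fixed proportion, the rest [g] of the
    mixture would have to compensate for it, which its lower bound forbids. *)
Lemma component_upper (t r w K : R) (f g h : R -> R) :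
  0 < w -> 0 < K -> (forall x, h x = w * f x + g x) ->
  (\forall x \near +oo, h x <= K * f x) ->
  ratio_upper h t r ->
  (forall e, 0 < e -> \forall x \near +oo, r * g x - e * h x <= g (x - t)) ->
  (forall x, 0 <= h x) ->
  ratio_upper f t r.
Proof.
move=> w0 K0 hE hK hup glo h0 q rq.
pose e := w * (q - r) / (2 * K).
have e0 : 0 < e by rewrite divr_gt0 ?mulr_gt0// subr_gt0.
have h1 : \forall x \near +oo, h (x - t) <= (r + e) * h x by apply: hup; lra.
have h2 := glo e e0.
near=> x.
have k1 : h (x - t) <= (r + e) * h x by near: x.
have k2 : r * g x - e * h x <= g (x - t) by near: x.
have k3 : h x <= K * f x by near: x.
rewrite -(ler_pM2l w0).
have k4 : 2 * e * h x <= w * (q - r) * f x.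
  apply: (@le_trans _ _ (2 * e * (K * f x))).
    by rewrite ler_wpM2l// mulr_ge0// ltW.
  by rewrite /e le_eqVlt; apply/orP; left; apply/eqP; field; lra.
have := hE (x - t); have := hE x; nra.
Unshelve. all: by end_near. Qed.

(** Suppose tail V (x - t) > q tail V (x) with q > exp(gamma t).  Choose an
    interval [[c, c + b[] of positive [U]-mass and look at [H] at the point
    z = x + c + b with the shift t' = t + b.  For each y in the interval,
    z - y >= x and z - t' - y <= x - t, so by monotonicity alone the excess
    persists at all these translates: tail V (z - t' - y) >= q tail V (z - y).
    For small b one still has q > exp(gamma t'), so the translates by y in
    the interval give a definite positive contribution to
    tail H (z - t') - exp(gamma t') tail H (z).  The other translates contribute
    at least a negligible amount, by the lower bound on the ratios of [V] when
    z - y is large and by smallness of the tail of [U] otherwise.  This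
    contradicts the upper bound on the ratios of [H]. *)
Lemma deconvolution_upper U V H gamma K :
  0 <= gamma -> 0 < K ->
  U `]-oo, 0%R[%classic = 0%E ->
  (forall x, tail H x = tail (conv_dist U V) x) ->
  (forall x, 0 < tail H x) ->
  (forall e, 0 < e -> \forall x \near +oo, tail U x <= e * tail V x) ->
  (\forall x \near +oo, tail H x <= K * tail V x) ->
  (forall t, 0 < t -> ratio_upper (tail H) t (expR (gamma * t))) ->
  (forall t, 0 < t -> ratio_lower (tail V) t (expR (gamma * t))) ->
  forall t, 0 < t -> ratio_upper (tail V) t (expR (gamma * t)).
Proof.
move=> g0 K0 U0 HE H0 UV HK Hup Vlo t t0 q Eq.
set E := expR _ in Eq; have E0 : 0 < E by exact: expR_gt0.
pose q' := (E + q) / 2.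
have Eq' : E < q' by rewrite /q'; lra.
have q'q : q' < q by rewrite /q'; lra.
(* This b satisfies exp(gamma b) <= q' / E, also when gamma = 0. *)
pose b := ln (q' / E) / (gamma + 1).
have q'E : 1 < q' / E by rewrite ltr_pdivlMr ?mul1r.
have b0 : 0 < b by rewrite divr_gt0 ?ln_gt0//; lra.
pose t' := t + b; have t'0 : 0 < t' by rewrite addr_gt0.
pose r' := expR (gamma * t').
have r'0 : 0 < r' by exact: expR_gt0.
have r'q' : r' <= q'.
  rewrite /r' mulrDr expRD -/E mulrC -ler_pdivlMr//.
  rewrite -[leRHS]lnK ?posrE; last by apply: lt_trans q'E.
  rewrite ler_expR /b mulrCA ger_pMr ?ln_gt0//.
  by rewrite ler_pdivrMr; lra.
have [c c0 m0] := exists_itv_mass U0 b0.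
set m := fine _ in m0.
(* The final inequality reads 6 e <= 3 e after division by the tail of H. *)
pose e := (q - q') * m / (6 * K).
have e0 : 0 < e by rewrite divr_gt0 ?mulr_gt0 ?subr_gt0.
have [M lo] : exists M, forall u, M < u -> (r' - e) * tail V u <= tail V (u - t').
  by apply: (near_pinftyP _).1; apply: Vlo => //; rewrite -/r'; lra.
pose A := Num.max M 0 + 1.
have MA : M < A by rewrite /A ltr_pwDr// le_max lexx.
have A0 : 0 < A by rewrite /A ltr_wpDl// le_max lexx orbT.
pose e' := e / (r' * (expR (gamma * A) + 1)).
have gA0 := expR_gt0 (gamma * A).
have e'0 : 0 < e' by rewrite divr_gt0// mulr_gt0// addr_gt0.
have n1 : \forall z \near +oo, tail H (z - t') <= (r' + e) * tail H z.
  by apply: Hup => //; rewrite -/r'; lra.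
have n2 : \forall z \near +oo, tail H (z - A) <= (expR (gamma * A) + 1) * tail H z.
  by apply: Hup => //; lra.
have n3 : \forall z \near +oo, tail U (z - A) <= e' * tail V (z - A).
  exact: (near_pinftyD (P := fun x => tail U x <= e' * tail V x)) (UV _ e'0).
have [N NP] : exists N, forall z, N < z ->
  [/\ tail H z <= K * tail V z, tail H (z - t') <= (r' + e) * tail H z,
    tail H (z - A) <= (expR (gamma * A) + 1) * tail H z &
    tail U (z - A) <= e' * tail V (z - A)].
  by apply: (near_pinftyP _).1; near=> z; split; near: z.
apply/near_pinftyP; exists (Num.max N A) => x; rewrite gt_max => /andP[Nx Ax].
rewrite leNgt; apply/negP => qV.
pose z := x + c + b.
have [|k1 k2 k3 k4] := NP z; first by rewrite /z; lra.
pose I : set R := `[c, c + b[%classic.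
pose J : set R := `]z - A, +oo[%classic.
have iI : U.-integrable setT (EFin \o (\1_I : R -> R)) by exact: (integrable_indicR _ (measurable_itv _)).
have iJ : U.-integrable setT (EFin \o (\1_J : R -> R)) by exact: (integrable_indicR _ (measurable_itv _)).
(* I carries the excess; J is where the lower bound on the ratios of V
   is not available. *)
have main : (q - q') * tail V z * m - r' * tail U (z - A) <=
    tail H (z - t') - (r' - e) * tail H z.
  rewrite !HE !tail_conv /m -(Rintegral_indic U (measurable_itv _)) -/I.
  rewrite (tail_indic U (z - A)) -/J -!RintegralZl//; last first.
    exact: integrable_tail_sub.
  rewrite -!RintegralB//; try exact: integrableZR.
  - apply: le_Rintegral => //.
    + by apply: integrableBR; exact: integrableZR.
    + apply: integrableBR; first exact: integrable_tail_sub.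
      by apply: integrableZR; exact: integrable_tail_sub.
    move=> y _ /=; rewrite !indicE.
    have zy : z - t' - y = z - y - t' by rewrite addrAC.
    case: (boolP (y \in I)) => [|_].
      rewrite inE /I/= in_itv/= => /andP[y1 y2].
      rewrite memNset/=; last first.
        by rewrite /J/= in_itv/= andbT; apply/negP; rewrite -leNgt /z; lra.
      have v1 : tail V (x - t) <= tail V (z - t' - y).
        by apply: tail_noninc; rewrite /z /t'; lra.
      have v2 : tail V (z - y) <= tail V x by apply: tail_noninc; rewrite /z; lra.
      have v3 : tail V z <= tail V (z - y) by apply: tail_noninc; lra.
      have v5 : q * tail V (z - y) <= q * tail V x by rewrite ler_wpM2l//; lra.
      have v6 : (r' - e) * tail V (z - y) <= q' * tail V (z - y).
        by rewrite ler_wpM2r ?tail_ge0//; lra.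
      have v7 : (q - q') * tail V z <= (q - q') * tail V (z - y).
        by rewrite ler_wpM2l//; lra.
      by rewrite mulr1 mulr0 subr0; lra.
    have V1 := tail_le1 V (z - y); have V0 := tail_ge0 V (z - y).
    case: (boolP (y \in J)) => [_|].
      have := tail_ge0 V (z - t' - y).
      have v5 : r' * tail V (z - y) <= r' * 1 by rewrite ler_wpM2l// ltW.
      have v6 : 0 <= e * tail V (z - y) by rewrite mulr_ge0// ltW.
      by rewrite mulr0 mulr1; lra.
    rewrite notin_setE /J/= in_itv/= andbT => /negP; rewrite -leNgt => yA.
    by rewrite !mulr0 subrr subr_ge0 zy; apply: lo; lra.
  - exact: integrable_tail_sub.
  - by apply: integrableZR; exact: integrable_tail_sub.
have k5 : r' * tail U (z - A) <= e * tail H z.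
  have VH : tail V (z - A) <= tail H (z - A) by rewrite HE tail_conv_ge.
  have k6 : tail U (z - A) <= e' * ((expR (gamma * A) + 1) * tail H z).
    by apply: (le_trans k4); rewrite ler_pM2l//; exact: le_trans k3.
  rewrite mulrC -ler_pdivlMr//; apply: (le_trans k6).
  by rewrite /e' le_eqVlt; apply/orP; left; apply/eqP; field; lra.
have k7 : (q - q') * m / K * tail H z <= (q - q') * tail V z * m.
  rewrite mulrAC ler_pdivrMr//.
  have := k1; have : 0 < (q - q') * m by rewrite mulr_gt0// subr_gt0.
  by nra.
have k8 : (q - q') * m / K = 6 * e by rewrite /e; field; lra.
have := H0 z; rewrite k8 in k7; nra.
Unshelve. all: by end_near. Qed.

(** If [H] were concentrated on a lattice of step d, its tail would be constant
    between some z - d / 2 and z with z arbitrarily large; but at each of the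
    translates forming [H] the tail of [V] drops there, together with that of
    [W].  The comparison with [W] spares any knowledge of the ratios of [V]. *)
Lemma conv_not_lattice U V W H w :
  U `]-oo, 0%R[%classic = 0%E ->
  (forall x, tail H x = tail (conv_dist U V) x) ->
  0 < w ->
  (forall x y, x <= y -> w * (tail W x - tail W y) <= tail V x - tail V y) ->
  (forall x, 0 < tail W x) ->
  (forall t, 0 < t -> exists2 r, 1 < r & ratio_lower (tail W) t r) ->
  ~ lattice H.
Proof.
move=> U0 HE w0 VW W0 low [c [d cd]]; have d0 : 0 < d by case: cd.
have [|r r1 lr] := low (d / 2); first by rewrite divr_gt0.
pose q := (1 + r) / 2; have q1 : 1 < q by rewrite /q; lra.
have /lr/near_pinftyP[M MP] : q < r by rewrite /q; lra.
have [b b0 m0] := exists_itv_mass U0 (ltr01).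
set m := fine _ in m0.
pose t := d / 2.
have [n Mn] : exists n : nat, M + b + 1 < c + d * n%:R.
  exists (Num.truncn (`|M + b + 1 - c| / d)).+1.
  have := truncnS_gt (`|M + b + 1 - c| / d); rewrite ltr_pdivrMr// => h.
  by have := ler_norm (M + b + 1 - c); lra.
pose z := c + d * n%:R + t.
have eqH : tail H (z - t) = tail H z.
  rewrite /z addrK -[n%:R]/((n%:Z)%:~R) (lattice_tail _ cd)//.
  by rewrite /t; lra.
pose I : set R := `[b, b + 1[%classic.
have iI : U.-integrable setT (EFin \o (\1_I : R -> R)) by exact: (integrable_indicR _ (measurable_itv _)).
have : w * ((q - 1) * tail W z) * m <= tail H (z - t) - tail H z.
  rewrite !HE !tail_conv /m -(Rintegral_indic U (measurable_itv _)) -/I.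
  rewrite -RintegralZl// -RintegralB//; try exact: integrable_tail_sub.
  apply: le_Rintegral => //; first exact: integrableZR.
    by apply: integrableBR; exact: integrable_tail_sub.
  move=> y _; rewrite indicE; case: (boolP (y \in I)) => /= [yI|_]; last first.
    by rewrite mulr0 subr_ge0; apply: tail_noninc; rewrite /t; lra.
  move: yI; rewrite inE /I/= in_itv/= => /andP[b1 b2].
  have h : q * tail W (z - y) <= tail W (z - t - y).
    by rewrite (addrAC z); apply: MP; rewrite /z /t; lra.
  have Wz : tail W z <= tail W (z - y) by apply: tail_noninc; lra.
  have qW : (q - 1) * tail W z <= (q - 1) * tail W (z - y).
    by rewrite ler_wpM2l// subr_ge0 ltW.
  rewrite mulr1; apply: le_trans (VW _ _ _); last by rewrite /t; lra.
  by rewrite ler_pM2l//; lra.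
rewrite eqH subrr leNgt => /negP; apply.
by rewrite !mulr_gt0// subr_gt0.
Qed.

End transfer.

(** * Compound Poisson distributions in OS *)

Section compound_poisson_OS.
Context {R : realType}.
Variables (mu gamma C : R) (F V : dist R).
Hypotheses (mu0 : 0 < mu) (F0 : F `]-oo, 0%R[%classic = 0%E).
Hypothesis VE : compound_poisson mu F V.
Hypotheses (C0 : 0 < C)
  (VC : \forall x \near +oo, tail (conv_dist V V) x <= C * tail V x).

Local Notation p := (poisson_weight mu).
Local Notation a k := (tail (conv_pow F k)).
Local Notation S n x := (\sum_(0 <= k < n) p k * a k x).

Let p_gt0 k : 0 < p k. Proof. exact: poisson_weight_gt0. Qed.

(** The remainder is at most mu / (n + 1) times the tail of F * V, which is
    O(tail V) because a multiple of it is dominated by V * V. *)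
Lemma remainder_small e m : 0 < e -> exists2 n, (m < n)%N &
  \forall x \near +oo, tail V x <= S n x + e * tail V x.
Proof.
move=> e0; pose D := mu * C / p 1.
have D0 : 0 < D by rewrite divr_gt0// mulr_gt0.
pose n := maxn m (Num.truncn (D / e)).+1.
exists n.+1; first by rewrite ltnS leq_maxl.
apply: filterS VC => x Vx.
apply: (le_trans (compound_poisson_remainder mu0 VE n x)); rewrite lerD2l.
have FV : tail (conv_dist F V) x <= C / p 1 * tail V x.
  rewrite mulrAC ler_pdivlMr// mulrC.
  exact: le_trans (conv_spectral_le mu0 VE x) Vx.
apply: (@le_trans _ _ (mu / n.+1%:R * (C / p 1 * tail V x))).
  by rewrite ler_wpM2l// divr_ge0 ?ltW.
rewrite mulrA; apply: ler_wpM2r; first exact: tail_ge0.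
have -> : mu / n.+1%:R * (C / p 1) = D / n.+1%:R by rewrite /D; ring.
rewrite ler_pdivrMr// mulrC -ler_pdivrMr//.
apply: (le_trans (ltW (truncnS_gt _))); rewrite ler_nat.
by apply: leqW; exact: leq_maxr.
Qed.

(** Half of the tail of [V] comes from a fixed finite number of terms, each
    dominated by any power of higher order. *)
Lemma compound_poisson_le_spectral : exists n, exists2 K, 0 < K &
  forall N, (n <= N)%N -> \forall x \near +oo, tail V x <= K * a N x.
Proof.
have half : 0 < 2^-1 :> R by [].
have [[//|n] _ nV] := remainder_small 0 half.
have ps0 : 0 < \sum_(0 <= k < n.+1) p k.
  by rewrite big_nat_recr//= ltr_wpDl// sumr_ge0// => k _; exact: ltW.
exists n, (2 * \sum_(0 <= k < n.+1) p k); first by rewrite mulr_gt0.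
move=> N nN; apply: filterS nV => x Vx.
have : S n.+1 x <= (\sum_(0 <= k < n.+1) p k) * a N x.
  rewrite mulr_suml; apply: ler_sum_nat => k /andP[_ kn].
  rewrite ler_pM2l//; apply: tail_conv_pow_le => //.
  by rewrite (leq_trans _ nN).
lra.
Qed.

Hypothesis lowF : forall k, (0 < k)%N -> forall t, 0 < t ->
  ratio_lower (a k) t (expR (gamma * t)).

(** The power of order 0 is the point mass at 0, whose tail vanishes on the
    half-line. *)
Lemma ratio_lower_pow k t : 0 < t -> ratio_lower (a k) t (expR (gamma * t)).
Proof.
move=> t0; case: k => [|k]; last exact: lowF.
move=> q _; apply/near_pinftyP; exists 0 => x x0.
rewrite [tail _ x](_ : _ = 0) ?mulr0 ?tail_ge0//.
rewrite -[LHS]/(fine (\d_(0 : R) `]x, +oo[%classic)) diracE memNset//=.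
by rewrite in_itv/= andbT; apply/negP; rewrite -leNgt ltW.
Qed.

Lemma compound_poisson_lower t : 0 < t ->
  ratio_lower (tail V) t (expR (gamma * t)).
Proof.
move=> t0 q qr; pose r := expR (gamma * t).
have e0 : 0 < r - q by rewrite subr_gt0.
have : \forall x \near +oo, r * tail V x - (r - q) * tail V x <= tail V (x - t).
  apply: (mixture_lower (c := p) (a := fun k => a k)) e0 => //.
  - exact: expR_ge0.
  - by move=> k; exact: ltW.
  - by move=> k x; exact: tail_ge0.
  - by move=> k; exact: ratio_lower_pow.
  - by move=> n x; exact: partial_compound_poisson_le.
  - by move=> e /(remainder_small 0)[n _ nV]; exists n.
apply: filterS => x; lra.
Qed.

Hypotheses (g0 : 0 <= gamma)
  (uppV : forall t, 0 < t -> ratio_upper (tail V) t (expR (gamma * t)))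
  (posF : forall k, (0 < k)%N -> forall x, 0 < a k x).

(** The compound Poisson law is split into its term of order [k] and all the
    others, and the latter again form a mixture with uniformly small
    remainders. *)
Lemma spectral_pow_upper k K : 0 < K ->
  (\forall x \near +oo, tail V x <= K * a k x) ->
  forall t, 0 < t -> ratio_upper (a k) t (expR (gamma * t)).
Proof.
move=> K0 VK t t0.
pose c j := if j != k then p j else 0.
have Sc m x : (k < m)%N ->
    S m x = p k * a k x + \sum_(0 <= j < m) c j * a j x.
  move=> km; rewrite (bigD1_seq k) ?iota_uniq//= ?mem_index_iota//.
  congr (_ + _); rewrite big_mkcond/=; apply: eq_bigr => j _.
  by rewrite /c; case: ifP; rewrite ?mul0r.
apply: (component_upper (g := fun x => tail V x - p k * a k x) (p_gt0 k) K0 _ VK (uppV t0)).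
- by move=> x; rewrite addrC subrK.
- apply: (mixture_lower (c := c) (a := fun k => a k)).
  + exact: expR_ge0.
  + by move=> j; rewrite /c; case: ifP => // _; exact: ltW.
  + by move=> j x; exact: tail_ge0.
  + by move=> j; exact: ratio_lower_pow.
  + move=> n x; rewrite lerBrDl.
    apply: le_trans (partial_compound_poisson_le mu0 VE (maxn n k.+1) x).
    rewrite Sc ?leq_maxr// lerD2l [leRHS](big_cat_nat (n := n)) ?leq_maxl//= lerDl.
    apply: sumr_ge0 => j _; rewrite mulr_ge0 ?tail_ge0// /c.
    by case: ifP => // _; exact: ltW.
  + by move=> x; rewrite gerBl mulr_ge0 ?tail_ge0// ltW.
  + move=> e /(remainder_small k)[n kn nV]; exists n; apply: filterS nV => x.
    by rewrite (Sc _ _ kn); lra.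
- by move=> x; exact: tail_ge0.
Qed.

(** The law [W] is only required to share its tail with the convolution power,
    so that the case [k = 1] covers [F] itself. *)
Lemma spectral_pow_LOS k K W : (0 < k)%N -> 0 < K ->
  (\forall x \near +oo, tail V x <= K * a k x) ->
  (forall x, tail W x = a k x) -> class_LOS gamma W.
Proof.
move=> k0 K0 VK WE; have WF : tail W = a k by apply/funext.
have W0 x : 0 < tail W x by rewrite WE; exact: posF.
split.
  apply: class_L_intro => //; rewrite WF; first by move=> t; exact: ratio_lower_pow.
  exact: spectral_pow_upper VK.
have WV u : tail W u <= (p k)^-1 * tail V u.
  by rewrite mulrC ler_pdivlMr// mulrC WE; exact: poisson_weight_tail_le.
apply: (bound_class_OS (C := (p k)^-1 ^+ 2 * (C * K)) W0).
apply: filterS2 VC VK => x VVx Vx.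
apply: (le_trans (le_tail_conv_selfZ x _ WV)); first by rewrite invr_ge0 ltW.
rewrite -(mulrA _ (C * K)); apply: ler_wpM2l; first exact: sqr_ge0.
apply: (le_trans VVx).
by rewrite -mulrA ler_pM2l// WE.
Qed.

End compound_poisson_OS.

(** * Convolution roots and the main theorem *)

Section closing.
Context {R : realType}.
Implicit Types (F V W : dist R).

(** Each further convolution factor [F] is dominated by the power of order [l]
    and then absorbed by the OS bound. *)
Lemma OS_pow_bound F l n : F `]-oo, 0%R[%classic = 0%E -> (0 < l)%N ->
  class_OS (conv_pow F l) ->
  exists2 K, 0 < K &
    forall x, tail (conv_pow F (l + n)) x <= K * tail (conv_pow F l) x.
Proof.
move=> F0 l0 /class_OS_global[C C0 lC].
elim: n => [|n [K K0 IH]]; first by exists 1 => // x; rewrite addn0 mul1r.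
exists (K * C); first exact: mulr_gt0.
move=> x; rewrite addnS/=.
apply: (le_trans (le_tail_convZ _ _ IH)); rewrite -mulrA ler_pM2l//.
apply: le_trans (lC x); rewrite tail_convC; apply: le_tail_conv => u.
by rewrite -tail_conv1; exact: tail_conv_pow_le.
Qed.

Lemma levy_mass_gt0 (ups : {measure set R -> \bar R}) :
  levy_measure ups -> 0 < levy_mass ups.
Proof. by move=> [_ pos fin _]; rewrite fine_gt0// pos. Qed.

Lemma levy_spectral_ge0 ups F : levy_spectral ups F ->
  F `]-oo, 0%R[%classic = 0%E.
Proof.
move=> /(_ 1); rewrite ltxx => F1; apply: subset_measure0 F1 => //.
by move=> z /=; rewrite !in_itv/= => z0; lra.
Qed.

End closing.

Theorem theorem1p1 (R : realType) (a gamma : R)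
    (ups : {measure set R -> \bar R}) (F H H1 H2 : dist R)
    (a_ge0 : 0 <= a) (gamma_ge0 : 0 <= gamma)
    (hups : levy_measure ups)
    (hF : levy_spectral ups F)
    (hH : id_with_levy_data a ups H)
    (hdec : levy_decomposition a ups F H1 H2 H)
    (hLOS : class_LOS gamma H)
    (hH1 : tail H1 =o_ +oo tail H2)
    (hliminf : forall k : nat, (0 < k)%N -> liminf_ratio_ge gamma (conv_pow F k)) :
  [/\ class_LOS gamma H2,
      tail H2 =O_ +oo tail H /\ tail H =O_ +oo tail H2,
      exists2 n0 : nat, (0 < n0)%N &
        forall n : nat, (n0 <= n)%N -> class_LOS gamma (conv_pow F n),
      forall n0 : nat, (1 < n0)%N ->
        (forall n : nat, (n0 <= n)%N -> class_LOS gamma (conv_pow F n)) ->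
        forall l0 : nat, (1 <= l0 <= n0.-1)%N -> class_OS (conv_pow F l0) ->
        forall n : nat, (l0 <= n)%N -> class_LOS gamma (conv_pow F n) &
      class_OS F -> class_LOS gamma F].
Proof.
have mu0 := levy_mass_gt0 hups; set mu := levy_mass ups in mu0.
have F0 := levy_spectral_ge0 hF.
have [[_ H10 _] VE HA] := hdec; rewrite -/mu in VE.
have HE x : tail H x = tail (conv_dist H1 H2) x by rewrite /tail HA.
have posF k : (0 < k)%N -> forall x, 0 < tail (conv_pow F k) x.
  by move=> /hliminf/liminf_ratio_ge_lower[].
have lowF k : (0 < k)%N -> forall t, 0 < t ->
    ratio_lower (tail (conv_pow F k)) t (expR (gamma * t)).
  by move=> /hliminf/liminf_ratio_ge_lower[].
have p0 := @poisson_weight_gt0 _ _ mu0.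
have F1 : tail (conv_pow F 1) = tail F by apply/funext => x; exact: tail_conv1.
have [HL HOS] := hLOS.
have [H0 HC] := class_OS_bound HOS.
(* This must precede any comparison of H with H2, since for a lattice law the
   class L(gamma) controls only shifts by multiples of the span. *)
have Hnl : gamma = 0 \/ ~ lattice H.
  have [->|gn0] := eqVneq gamma 0; [by left|right].
  apply: (conv_not_lattice (W := F) (w := poisson_weight mu 1) H10 HE) => //.
  - by move=> x y; exact: compound_poisson_increments.
  - by move=> x; rewrite -tail_conv1; exact: posF.
  - move=> t t0; exists (expR (gamma * t)); last by rewrite -F1; exact: lowF.
    by rewrite expR_gt1 mulr_gt0// lt_neqAle eq_sym gn0.
have Hup t : 0 < t -> ratio_upper (tail H) t (expR (gamma * t)).
  by move=> t0; case: (class_L_elim HL Hnl t0).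
have UV e : 0 < e -> \forall x \near +oo, tail H1 x <= e * tail H2 x.
  move=> e0; have /eqoP/(_ e e0) := hH1; apply: filterS => x.
  by rewrite !ger0_norm ?tail_ge0.
have [K K0 HK] := tail_conv_comparable H10 HE UV HC Hup.
have [C C0 HHC] := HC.
have VH x : tail H2 x <= tail H x by rewrite HE tail_conv_ge.
have V0 x : 0 < tail H2 x.
  apply: lt_le_trans (poisson_weight_tail_le mu0 VE 1 x).
  by rewrite mulr_gt0// posF.
have CK0 : 0 < C * K by rewrite mulr_gt0.
have VC : \forall x \near +oo, tail (conv_dist H2 H2) x <= C * K * tail H2 x.
  apply: filterS2 HHC HK => x h1 h2.
  have VH' u : tail H2 u <= 1 * tail H u by rewrite mul1r.
  apply: (le_trans (le_tail_conv_selfZ x ler01 VH')).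
  by rewrite expr1n mul1r -mulrA (le_trans h1)// ler_pM2l.
have Vlow := @compound_poisson_lower _ _ _ _ _ _ mu0 VE CK0 VC lowF.
have Vup := deconvolution_upper gamma_ge0 K0 H10 HE H0 UV HK Hup Vlow.
have LOS := @spectral_pow_LOS _ _ _ _ _ _ mu0 VE CK0 VC lowF gamma_ge0 Vup posF.
have [n0 [K' K'0 n0P]] := compound_poisson_le_spectral mu0 F0 VE CK0 VC.
have tailOS l : (0 < l)%N -> class_OS (conv_pow F l) ->
    exists2 K, 0 < K & forall n, (l <= n)%N ->
      \forall x \near +oo, tail H2 x <= K * tail (conv_pow F n) x.
  move=> l0 lOS; have [B B0 lB] := OS_pow_bound n0 F0 l0 lOS.
  exists (K' * B); first exact: mulr_gt0.
  move=> n ln; apply: filterS (n0P _ (leq_addl l n0)) => x /le_trans; apply.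
  rewrite -mulrA ler_pM2l//; apply: (le_trans (lB x)); rewrite ler_pM2l//.
  exact: tail_conv_pow_le.
split.
- split; first exact: class_L_intro.
  exact: bound_class_OS VC.
- split; apply/eqO_exP.
    exists 1 => //; apply: nearW => x.
    by rewrite mul1r !ger0_norm ?tail_ge0.
  by exists K => //; apply: filterS HK => x; rewrite !ger0_norm ?tail_ge0.
- exists n0.+1 => // n n0n; apply: LOS K'0 (n0P n _) _ => //.
    exact: leq_trans n0n.
  exact: ltnW.
- move=> m _ _ l /andP[l0 _] lOS n ln.
  have [B B0 lB] := tailOS l l0 lOS.
  by apply: LOS B0 (lB n ln) _ => //; exact: leq_trans ln.
- move=> FOS.
  have F1OS : class_OS (conv_pow F 1).
    have [F'0 [B B0 FB]] := class_OS_bound FOS.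
    apply: (bound_class_OS (C := B)); first exact: posF.
    apply: filterS FB => x FBx; rewrite F1; apply: le_trans FBx.
    have FF u : tail (conv_pow F 1) u <= 1 * tail F u by rewrite F1 mul1r.
    by have := le_tail_conv_selfZ x ler01 FF; rewrite expr1n mul1r.
  have [B B0 lB] := tailOS 1%N isT F1OS.
  by apply: LOS B0 (lB 1%N _) _ => // x; rewrite F1.
Qed.
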